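(* Let $\eta_0>0$ be a constant and $\{G(m)\}_{m\ge1}$ a family of connected $3$-regular graphs such that $|V(G(m))|=2m$ and $h(G(m))\ge\eta_0$ for every $m\ge 1$, and set $$\alpha_0=\min\left\{\frac12,\frac{\eta_0}{4+\eta_0}\right\}>0 .$$ Then for every $\theta>0$ there exist a function $n:\mathbb N\to\mathbb N$ and a family of connected graphs $\{H(g)\}_{g\ge2}$ such that (i) $H(g)\in\mathcal F_{g,n(g)}$ for all $g\ge2$; (ii) $\displaystyle\lim_{g\to\infty}\frac{n(g)}{g}=\theta$; (iii) $\displaystyle\lambda_1(H(g))\ge\frac{\alpha_0^2}{2(\theta+3)^2}$ for all $g\ge 2$.
   Context: Graphs are finite; multiple edges and loops (at degree-$3$ vertices) are allowed, and a loop contributes $2$ to the degree of its vertex. For non-negative integers $g,n$ with $2g-2+n>0$, $\mathcal F_{g,n}$ is the set of connected graphs $G$ with a decomposition $V(G)=V'(G)\sqcup\delta G$ such that $|V'(G)|=2g-2+n$, $|\delta G|=n$, every vertex of $V'(G)$ has degree $3$ and every vertex of $\delta G$ has degree $1$. Cheeger constant: for $\Omega\subseteq V(G)$, $\partial\Omega$ is the set of edges joining a vertex of $\Omega$ to a vertex of $\Omega^c$, and $h(G)=\inf\{|\partial\Omega|/|\Omega|:\ \emptyset\ne\Omega\subseteq V(G),\ |\Omega|\le|V(G)|/2\}$. Graph Laplacian: for $f:V(G)\to\mathbb R$, $\Delta_Gf(v)=\frac1{\deg(v)}\sum_{w\sim v}(f(w)-f(v))$, the sum being over edges joining $v$ to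 $w$ (counted with multiplicity; loops contribute $0$). The eigenvalues of $-\Delta_G$, counted with multiplicity, are $0=\lambda_0(G)<\lambda_1(G)\le\lambda_2(G)\le\cdots$. The paper fixes one constant $\eta_0$ and one family $\{G(m)\}$ with the stated properties; such families exist by known explicit constructions of cubic expander (multi)graphs. *)

(* Defs.v *)
From HB Require Import structures.
From mathcomp Require Import all_boot all_order all_algebra.
From mathcomp Require Import all_classical all_reals all_analysis.

Set Implicit Arguments.
Unset Strict Implicit.
Unset Printing Implicit Defensive.

Import Order.TTheory GRing.Theory Num.Theory.
Import numFieldNormedType.Exports.

Local Open Scope ring_scope.

(* Multiple edges and loops are allowed.  The orientation of an edge given by
   (src, tgt) is an artefact of the encoding: every notion below is invariant
   under swapping the two endpoints of an edge. *)
Record multigraph := Multigraph {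
  vertex : finType;
  edge : finType;
  src : edge -> vertex;
  tgt : edge -> vertex }.

Section Graph.
Variable G : multigraph.
Implicit Types (v w : vertex G) (e : edge G) (A : {set vertex G}).

(* A loop is counted once in each of the two sums, hence contributes 2. *)
Definition degree v : nat :=
  (#|[set e | src e == v]| + #|[set e | tgt e == v]|)%N.

Definition adjacent : rel (vertex G) := fun v w =>
  [exists e, ((src e == v) && (tgt e == w)) || ((src e == w) && (tgt e == v))].

Definition mg_connected : Prop :=
  (0 < #|vertex G|)%N /\ forall v w, connect adjacent v w.

Definition regular (d : nat) : Prop := forall v, degree v = d.

Definition edge_boundary A : {set edge G} :=
  [set e | (src e \in A) != (tgt e \in A)].

(* The stability condition 2g - 2 + n > 0 and the count |V'| = 2g - 2 + n are
   written additively, because subtraction on nat is truncated. *)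
Definition in_F (g n : nat) : Prop :=
  [/\ (2 < 2 * g + n)%N,
      mg_connected &
      exists dG : {set vertex G},
        [/\ (#|~: dG| + 2 = 2 * g + n)%N, #|dG| = n,
            (forall v, v \notin dG -> degree v = 3%N) &
            (forall v, v \in dG -> degree v = 1%N)]].

End Graph.

Section Analytic.
Variables (R : realType) (G : multigraph).

Definition cheeger : R :=
  inf [set (#|edge_boundary A|%:R / #|A|%:R : R) | A in
        [set A : {set vertex G} | A != finset.set0 /\
                                  (2 * #|A| <= #|vertex G|)%N]]%classic.

(* Each non-loop edge at v occurs in exactly one of the two sums; a loop
   occurs in both, with value 0. *)
Definition laplacian (f : {ffun vertex G -> R^o}) : {ffun vertex G -> R^o} :=
  [ffun v => (degree v)%:R^-1 *
     (\sum_(e : edge G | src e == v) (f (tgt e) - f v) +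
      \sum_(e : edge G | tgt e == v) (f (src e) - f v))].

Fact laplacian_is_linear : linear laplacian.
Proof.
move=> a f h; apply/ffunP => v; rewrite !ffunE.
have -> : forall c x : R^o, a *: (c * x) = c * (a *: x).
  by move=> c x; exact: mulrCA.
rewrite -mulrDr scalerDr !scaler_sumr addrACA -!big_split /=.
by congr (_ * (_ + _)); apply: eq_bigr => e _;
  rewrite !ffunE scalerBr opprD addrACA.
Qed.

HB.instance Definition _ :=
  GRing.isLinear.Build R {ffun vertex G -> R^o} {ffun vertex G -> R^o} _
    laplacian laplacian_is_linear.

Definition neg_laplacian : 'End({ffun vertex G -> R^o}) := - linfun laplacian.

(* The nondecreasing list of the real eigenvalues of an endomorphism, each
   repeated according to the dimension of its eigenspace.  At most one list
   satisfies the condition, and one exists since there are finitely many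
   eigenvalues.  The Laplacian is self-adjoint for the degree-weighted inner
   product, so its eigenvalues are real and algebraic and geometric
   multiplicities agree. *)
Definition spectrum (V : vectType R) (u : 'End(V)) : seq R :=
  xget [::] [set s : seq R | sorted <=%R s /\
                   forall a, count_mem a s = \dim (passmx.leigenspace u a)]%classic.

(* Eigenvalue number k of the negated Laplacian, starting from 0. *)
Definition lambda (k : nat) : R := (spectrum neg_laplacian)`_k.

End Analytic.

(* Main.v *)
Require Import Defs.
From mathcomp Require Import all_boot all_order all_algebra.
From mathcomp Require Import complex.
From mathcomp Require Import all_classical all_reals all_analysis.
From mathcomp Require Import ring lra zify.

Import Order.TTheory GRing.Theory Num.Theory.
Import numFieldNormedType.Exports.

Local Open Scope ring_scope.

(** The graph H(g) is obtained from the cubic expander G(g - 1): distribute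
    n(g) = floor (theta (g - 1)) new vertices as evenly as possible over its
    3(g - 1) edges, subdividing the edges, and hang one leaf on each new vertex.
    This produces 2g - 2 + n(g) vertices of degree 3 and n(g) leaves
    ([in_F_hang_leaves]), and n(g) / g tends to theta
    ([truncn_mul_pred_cvg]).  No edge receives more than M = theta / 3 + 1 new
    vertices, which is (theta + 3) / 3 and explains the shape of the bound.

    The spectral gap is transported as an inequality between quadratic forms
    rather than through the Cheeger constant of H(g).  Call c a Poincare
    constant of a graph if every function f admits a number t such that c times
    the degree-weighted sum of (f - t)^2 is at most the Dirichlet energy of f, the
    sum of the squared differences of f along the edges.

    - The discrete Cheeger inequality ([cheeger_poincare]): a d-regular graph of
      Cheeger constant at least eta has the Poincare constant
      eta^2 / (2 d^2).  One takes for t a median of f, treats the positive and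
      the negative part of f - t separately, and applies the co-area inequality
      ([coarea]) to their squares.

    - Subdividing and hanging leaves costs a factor of order M^2
      ([poincare_hang_leaves]).  On the path that replaces an edge, f differs
      from its value at either end by at most what the energy of the path
      allows, and conversely the energy of the path is at least the squared
      difference at its ends divided by its length; both are the
      Cauchy-Schwarz inequality [path_sqr].

    - A Poincare constant c bounds lambda 1 from below ([poincare_lambda1]).
      By Green's formula, an eigenfunction of a nonzero eigenvalue a has
      weighted mean 0 and energy a times its weighted square norm, so that
      c <= a; for the eigenvalue 0 the energy vanishes, so that the
      eigenfunction is constant and the eigenvalue is simple.  As entry 1
      of a list with fewer than two elements would be a default value, the
      existence of a nonzero eigenvalue matters; it comes from the spectral
      theorem for the symmetric matrix D^(-1/2) L D^(-1/2), where D is the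
      diagonal matrix of the degrees and L the matrix of the Dirichlet form.

    Connectedness of H(g) is a consequence of the Poincare inequality, applied
    to the indicator function of a connected component
    ([poincare_connected]).  What remains is arithmetic: with
    alpha <= 1 / 2 and alpha <= eta / 4, the constant obtained for H(g) is at
    least alpha^2 / (18 M^2) = alpha^2 / (2 (theta + 3)^2). *)

(** * Energy, spread and Poincare inequalities *)

Definition energy {R : realType} {G : multigraph} (f : vertex G -> R) : R :=
  \sum_(e : edge G) (f (src e) - f (tgt e)) ^+ 2.

(** Since each edge contributes both of its ends, a vertex is weighted by its
    degree: this is the square of the distance from f to the constant t in the
    norm for which the Laplacian is self-adjoint. *)
Definition spread {R : realType} {G : multigraph}
    (f : vertex G -> R) (t : R) : R :=
  \sum_(e : edge G) ((f (src e) - t) ^+ 2 + (f (tgt e) - t) ^+ 2).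

(** The optimal t is the weighted mean of f.  It is left unspecified because the
    Cheeger argument produces a median instead, and the extension to a larger
    graph reuses the number found on the smaller one. *)
Definition poincare {R : realType} (c : R) (G : multigraph) : Prop :=
  forall f : vertex G -> R, exists t : R, c * spread f t <= energy f.

Lemma energy_ge0 {R : realType} {G : multigraph} (f : vertex G -> R) :
  0 <= energy f.
Proof. by apply: sumr_ge0 => e _; apply: sqr_ge0. Qed.

Lemma spread_ge0 {R : realType} {G : multigraph} (f : vertex G -> R) t :
  0 <= spread f t.
Proof. by apply: sumr_ge0 => e _; apply: addr_ge0; apply: sqr_ge0. Qed.

Lemma degree_sum (G : multigraph) (v : vertex G) :
  degree v = (\sum_(e : edge G) ((src e == v) + (tgt e == v)))%N.
Proof.
rewrite /degree big_split /=.
by congr (_ + _)%N; rewrite -sum1dep_card big_mkcond /=;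
  apply: eq_bigr => e _; case: eqP.
Qed.

Lemma sum_degree {R : realType} {G : multigraph} (f : vertex G -> R) :
  \sum_v (degree v)%:R * f v = \sum_(e : edge G) (f (src e) + f (tgt e)).
Proof.
under eq_bigr => v _ do rewrite degree_sum natr_sum mulr_suml.
rewrite exchange_big /=; apply: eq_bigr => e _.
under eq_bigr => v _ do rewrite natrD mulrDl.
by rewrite big_split /= (bigD1 (src e)) //= [X in _ + X](bigD1 (tgt e)) //=
  !eqxx !mul1r !big1 ?addr0 // => v; rewrite eq_sym => /negbTE->; rewrite mul0r.
Qed.

Lemma card_edge_regular (G : multigraph) (d : nat) :
  regular G d -> (2 * #|edge G| = d * #|vertex G|)%N.
Proof.
move=> Gd; have : (\sum_(v : vertex G) degree v = \sum_(e : edge G) 2)%N.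
  under eq_bigr => v _ do rewrite degree_sum.
  rewrite exchange_big /=; apply: eq_bigr => e _; rewrite big_split /=.
  by rewrite (bigD1 (src e)) //= [X in (_ + X)%N](bigD1 (tgt e)) //= !eqxx
    !big1 // => v; rewrite eq_sym => /negbTE->.
under eq_bigr => v _ do rewrite Gd.
by rewrite !sum_nat_const => h; rewrite mulnC [RHS]mulnC; apply: esym.
Qed.

(** The indicator function of a connected component has energy 0, hence spread 0
    around some t, so that it takes the value t at both ends of every edge.  As
    every vertex is the end of an edge, the component is everything. *)
Lemma poincare_connected {R : realType} (c : R) (G : multigraph) :
  0 < c -> (0 < #|vertex G|)%N -> (forall v : vertex G, (0 < degree v)%N) ->
  poincare c G -> mg_connected G.
Proof.
move=> c0 G0 dG pG; split=> // v w.
have [t ft] := pG (fun x => (connect (@Defs.adjacent G) v x)%:R).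
have E0 : energy (fun x => (connect (@Defs.adjacent G) v x)%:R) = 0 :> R.
  apply: big1 => e _.
  have -> : connect (@Defs.adjacent G) v (src e) =
            connect (@Defs.adjacent G) v (tgt e).
    apply/idP/idP => /connect_trans; apply; apply: connect1;
      by apply/existsP; exists e; rewrite !eqxx ?orbT.
  by rewrite subrr expr0n.
have fS : spread (fun x => (connect (@Defs.adjacent G) v x)%:R) t = 0.
  apply/eqP; rewrite eq_le spread_ge0 andbT -(ler_pM2l c0) mulr0.
  by rewrite -E0.
have ct (x : vertex G) : (connect (@Defs.adjacent G) v x)%:R = t.
  have := dG x; rewrite degree_sum lt0n sum_nat_eq0 negb_forall => /existsP [e].
  rewrite /= addn_eq0 !eqb0 negb_and !negbK => xe.
  move/eqP: fS; rewrite psumr_eq0 => [|e' _]; last by rewrite addr_ge0 ?sqr_ge0.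
  move=> /allP /(_ e); rewrite mem_index_enum => /(_ isT) /=.
  rewrite paddr_eq0 ?sqr_ge0 // !sqrf_eq0 !subr_eq0 => /andP [/eqP s /eqP t'].
  by case/orP: xe => /eqP <-.
have := ct w; rewrite -(ct v) connect0; case: connect => // /eqP.
by rewrite eq_sym oner_eq0.
Qed.

(** * The discrete Cheeger inequality *)

Lemma edge_boundary_le {R : realType} (G : multigraph) (A : {set vertex G}) :
  A != finset.set0 -> (2 * #|A| <= #|vertex G|)%N ->
  cheeger R G * #|A|%:R <= #|edge_boundary A|%:R.
Proof.
move=> A0 A2; rewrite -ler_pdivlMr ?ltr0n ?card_gt0 //.
apply: ge_inf; last by exists A.
by exists 0 => _ [B _ <-]; rewrite divr_ge0.
Qed.

Lemma natr_card {R : realType} {T : finType} (A : {set T}) :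
  #|A|%:R = \sum_x (x \in A)%:R :> R.
Proof.
by rewrite -sum1_card natr_sum big_mkcond /=; apply: eq_bigr => x _; case: ifP.
Qed.

(** Co-area inequality, by peeling off level sets.  Let m be the least value of
    h on its support A.  Lowering h by m on A lowers the left-hand sum by
    m * #|A| and the right-hand one by m * #|edge_boundary A|, and the
    definition of the Cheeger constant compares the two; the support has become
    smaller. *)
Lemma coarea {R : realType} (G : multigraph) (h : vertex G -> R) :
  (forall v, 0 <= h v) -> (2 * #|[set v | (0 < h v)%R]| <= #|vertex G|)%N ->
  cheeger R G * (\sum_v h v) <= \sum_(e : edge G) `|h (src e) - h (tgt e)|.
Proof.
have [n] := ubnP #|[set v | (0 < h v)%R]|; elim: n h => // n IHn h.
set A := [set v | _]%SET => An h0 A2.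
have [A0|/set0Pn [v0 v0A]] := eqVneq A finset.set0.
  rewrite [X in _ * X]big1 ?mulr0 ?sumr_ge0 // => v _; apply/eqP.
  have : v \notin A by rewrite A0 finset.in_set0.
  by rewrite inE -leNgt => hv; rewrite eq_le hv h0.
have [w wA wmin] := arg_minP h v0A.
pose h' v := h v - h w * (v \in A)%:R.
have {}wA : w \in A by [].
have hw : 0 < h w by move: wA; rewrite inE.
have hA v : v \notin A -> h v = 0.
  by rewrite inE -leNgt => hv; apply/eqP; rewrite eq_le hv h0.
have h'0 v : 0 <= h' v.
  rewrite /h'; have [vA|/hA->] := boolP (v \in A).
    by rewrite mulr1 subr_ge0 wmin.
  by rewrite mulr0 subr0.
have A'A : [set v | (0 < h' v)%R]%SET \proper A.
  apply/properP; split; last first.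
    by exists w => //; rewrite inE /h' wA mulr1 subrr ltxx.
  apply/fintype.subsetP => v; rewrite !inE; apply: contraTT.
  rewrite -!leNgt => hv.
  by rewrite /h' inE ltNge hv mulr0 subr0.
have A'lt := proper_card A'A.
have IH := IHn h' (leq_trans A'lt An) h'0
  (leq_trans (leq_mul (leqnn 2) (ltnW A'lt)) A2).
have sumh : \sum_v h v = \sum_v h' v + h w * #|A|%:R.
  rewrite natr_card mulr_sumr -big_split /=.
  by apply: eq_bigr => v _; rewrite /h' subrK.
have sume : \sum_(e : edge G) `|h (src e) - h (tgt e)| =
    \sum_(e : edge G) `|h' (src e) - h' (tgt e)| + h w * #|edge_boundary A|%:R.
  rewrite natr_card mulr_sumr -big_split /=.
  apply: eq_bigr => e _; rewrite inE.
  move: (h'0 (src e)) (h'0 (tgt e)); rewrite /h'.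
  have [sA|/hA->] := boolP (src e \in A);
    have [tA|/hA->] := boolP (tgt e \in A);
    rewrite ?mulr1 ?mulr0 ?subr0 ?addr0 ?sub0r /= => hs ht.
  - by congr `|_|; ring.
  - by rewrite !ger0_norm ?h0 // subrK.
  - by rewrite !normrN !ger0_norm ?h0 // subrK.
  - by [].
rewrite sumh sume mulrDr; apply: lerD => //.
rewrite mulrCA; apply: ler_wpM2l; first exact: ltW.
by apply: edge_boundary_le => //; apply/set0Pn; exists w.
Qed.

(** The least value t = f w such that at least half of the points satisfy
    f v <= t.  If more than half satisfied f v < t, then the greatest value
    below t would have the same property. *)
Lemma median {R : realType} {T : finType} (f : T -> R) : (0 < #|T|)%N ->
  exists t, (2 * #|[set v | (t < f v)%R]| <= #|T|)%N /\
            (2 * #|[set v | (f v < t)%R]| <= #|T|)%N.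
Proof.
move=> T0; pose P w := (#|T| <= 2 * #|[set v | (f v <= f w)%R]|)%N.
have [x0 _] : exists x0 : T, x0 \in T by apply/card_gt0P.
have [w0 _ w0max] := @arg_maxP _ _ _ x0 predT f isT.
have Pw0 : P w0.
  rewrite /P [X in (2 * X)%N](_ : _ = #|T|) ?mul2n -?addnn ?leq_addr //.
  by apply: eq_card => v; rewrite !inE; apply: w0max.
have [w Pw wmin] := @arg_minP _ _ _ w0 P f Pw0.
exists (f w); split.
  have := cardsC [set v | (f v <= f w)%R].
  have -> : ~: [set v | (f v <= f w)%R] = [set v | (f w < f v)%R].
    by apply/setP => v; rewrite !inE ltNge.
  by move: Pw; rewrite /P; lia.
rewrite leqNgt; apply/negP => lt_w.
have [x1 x1A] : exists x, x \in [set v | (f v < f w)%R].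
  by apply/card_gt0P; lia.
have [x xA xmax] := @arg_maxP _ _ _ x1 [in [set v | (f v < f w)%R]] f x1A.
have {}xA : x \in [set v | (f v < f w)%R] by [].
have Px : P x.
  rewrite /P (leq_trans (ltnW lt_w)) // leq_mul2l /=.
  by apply/subset_leq_card/fintype.subsetP => v vA; rewrite inE; apply: xmax.
by have := wmin _ Px; move: xA; rewrite inE => /lt_geF->.
Qed.

(** Apply the co-area inequality to g ^+ 2 and factor x ^+ 2 - y ^+ 2 as
    (x - y) * (x + y).  The first factor gives the energy; the second one is
    bounded by the sum of the squares of g, a contribution that half of the
    left-hand side absorbs. *)
Lemma cheeger_half {R : realType} (G : multigraph) (d : nat) (eta : R)
    (g : vertex G -> R) :
  (0 < d)%N -> regular G d -> 0 < eta -> eta <= cheeger R G ->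
  (forall v, 0 <= g v) -> (2 * #|[set v | (0 < g v)%R]| <= #|vertex G|)%N ->
  eta ^+ 2 * (\sum_v g v ^+ 2) <= 2 * d%:R * energy g.
Proof.
move=> d0 Gd eta0 etah g0 g2.
have gsq v : (0 < g v ^+ 2) = (0 < g v).
  by rewrite lt0r sqrf_eq0 sqr_ge0 andbT lt0r g0 andbT.
have co : eta * (\sum_v g v ^+ 2) <=
    \sum_(e : edge G) `|g (src e) ^+ 2 - g (tgt e) ^+ 2|.
  apply: le_trans (coarea _ (fun v => g v ^+ 2) _ _).
  - by rewrite ler_wpM2r // sumr_ge0 // => v _; rewrite sqr_ge0.
  - by move=> v; apply: sqr_ge0.
  - apply: leq_trans g2; rewrite leq_mul2l /=; apply/eq_leq/eq_card => v.
    by rewrite !inE gsq.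
have sumsq : \sum_(e : edge G) (g (src e) ^+ 2 + g (tgt e) ^+ 2) =
    d%:R * \sum_v g v ^+ 2.
  rewrite -(sum_degree (fun v => g v ^+ 2)) mulr_sumr.
  by apply: eq_bigr => v _; rewrite Gd.
(* This is 2 * p * q <= p ^+ 2 + q ^+ 2 for p = 2 * d * `|x - y| and
   q = eta * (x + y), followed by (x + y) ^+ 2 <= 2 * (x ^+ 2 + y ^+ 2).  The
   weights are chosen so that, after summation, the last term is half of the
   co-area lower bound. *)
have am (e : edge G) : 2 * (eta * d%:R) * `|g (src e) ^+ 2 - g (tgt e) ^+ 2| <=
    2 * d%:R ^+ 2 * (g (src e) - g (tgt e)) ^+ 2 +
    eta ^+ 2 * (g (src e) ^+ 2 + g (tgt e) ^+ 2).
  set x := g _; set y := g _; have dR : 0 <= d%:R :> R by [].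
  have -> : x ^+ 2 - y ^+ 2 = (x - y) * (x + y) by ring.
  rewrite normrM (@ger0_norm _ (x + y)) ?addr_ge0 ?g0 //.
  have xy := real_normK (num_real (x - y)).
  have := sqr_ge0 (2 * d%:R * `|x - y| - eta * (x + y)).
  have := sqr_ge0 (eta * (x - y)).
  have -> : (2 * d%:R * `|x - y| - eta * (x + y)) ^+ 2 =
      4 * d%:R ^+ 2 * `|x - y| ^+ 2 - 4 * (eta * d%:R) * (`|x - y| * (x + y))
      + eta ^+ 2 * (x + y) ^+ 2 by ring.
  by rewrite xy; lra.
have := @ler_sum _ _ (index_enum (edge G)) xpredT _ _ (fun e _ => am e).
rewrite -mulr_sumr big_split /= -!mulr_sumr sumsq -/(energy g) => h.
have dR : 0 < d%:R :> R by rewrite ltr0n.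
rewrite -(ler_pM2l dR).
have := ler_wpM2l (ltW (mulr_gt0 eta0 dR)) co.
nra.
Qed.

(** The discrete Cheeger inequality.  With t a median, the positive part p and
    the negative part n of f - t are supported on at most half of the vertices,
    so [cheeger_half] applies to each of them. *)
Lemma cheeger_poincare {R : realType} (G : multigraph) (d : nat) (eta : R) :
  (0 < #|vertex G|)%N -> (0 < d)%N -> regular G d -> 0 < eta ->
  eta <= cheeger R G -> poincare (eta ^+ 2 / (2 * d%:R ^+ 2)) G.
Proof.
move=> G0 d0 Gd eta0 etah f; have [t [tp tn]] := median f G0; exists t.
pose p v := Num.max (f v - t) 0; pose n v := Num.max (t - f v) 0.
have hp : eta ^+ 2 * (\sum_v p v ^+ 2) <= 2 * d%:R * energy p.
  apply: cheeger_half => // [v|]; first by rewrite le_max lexx orbT.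
  apply: leq_trans tp; rewrite leq_mul2l /=; apply/eq_leq/eq_card => v.
  by rewrite !inE lt_max ltxx orbF subr_gt0.
have hn : eta ^+ 2 * (\sum_v n v ^+ 2) <= 2 * d%:R * energy n.
  apply: cheeger_half => // [v|]; first by rewrite le_max lexx orbT.
  apply: leq_trans tn; rewrite leq_mul2l /=; apply/eq_leq/eq_card => v.
  by rewrite !inE lt_max ltxx orbF subr_gt0.
(* Truncation is a contraction, and at the ends of an edge where f - t changes
   sign the cross term has the favourable sign. *)
have Epn : energy p + energy n <= energy f.
  rewrite -big_split /=; apply: ler_sum => e _; rewrite /p /n.
  case: (@leP _ _ (f (src e) - t) 0) => ?;
  case: (@leP _ _ (f (tgt e) - t) 0) => ?;
  case: (@leP _ _ (t - f (src e)) 0) => ?;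
  case: (@leP _ _ (t - f (tgt e)) 0) => ?;
  nra.
have -> : spread f t = d%:R * (\sum_v p v ^+ 2 + \sum_v n v ^+ 2).
  rewrite /spread -(sum_degree (fun v => (f v - t) ^+ 2)) -big_split mulr_sumr /=.
  apply: eq_bigr => v _; rewrite Gd /p /n; congr (_ * _).
  by case: (@leP _ _ (f v - t) 0) => ?; case: (@leP _ _ (t - f v) 0) => ?; nra.
have dR : 0 < d%:R :> R by rewrite ltr0n.
rewrite mulrAC ler_pdivrMr ?mulr_gt0 ?exprn_gt0 //.
nra.
Qed.

(** * Subdividing the edges and hanging leaves *)

(** One element for each inserted vertex.  As one leaf hangs on each of them,
    the same type indexes the leaves. *)
Definition slot (G : multigraph) (k : edge G -> nat) : finType :=
  {e : edge G & 'I_(k e)}.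

(** The path that replaces the edge e, run through from its source.  Positions
    are natural numbers, so that the i-th edge of the path joins positions i
    and i.+1; the position after the last inserted vertex is the target. *)
Definition walk {G : multigraph} (k : edge G -> nat) (e : edge G) (i : nat) :
    vertex G + (slot G k + slot G k) :=
  if i is j.+1 then
    if insub j is Some p then inr (inl (@Tagged _ e (fun e => 'I_(k e)) p))
    else inl (tgt e)
  else inl (src e).

Arguments walk {G} k e i : simpl never.

(** In the vertex type, the three summands are the old vertices, the inserted
    vertices and the leaves.  In the edge type, the first summand gathers the
    k e + 1 edges of the path that replaces e, the second one the stems of the
    leaves. *)
Definition hang_leaves (G : multigraph) (k : edge G -> nat) : multigraph :=
  @Multigraph (vertex G + (slot G k + slot G k))%type
    ({e : edge G & 'I_(k e).+1} + slot G k)%type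
    (fun x => match x with
              | inl p => walk k (tag p) (tagged p)
              | inr p => inr (inl p) end)
    (fun x => match x with
              | inl p => walk k (tag p) (tagged p).+1
              | inr p => inr (inr p) end).

Lemma walk_inner {G : multigraph} (k : edge G -> nat) (e : edge G)
    (j : 'I_(k e)) :
  walk k e j.+1 = inr (inl (@Tagged _ e (fun e => 'I_(k e)) j)).
Proof. by rewrite /walk valK. Qed.

Lemma walk_last {G : multigraph} (k : edge G -> nat) (e : edge G) :
  walk k e (k e).+1 = inl (tgt e).
Proof. by rewrite /walk insubF // ltnn. Qed.

Lemma big_slot {R : Type} {idx : R} (op : Monoid.com_law idx) {I : finType}
    (k : I -> nat) (F : {i : I & 'I_(k i)} -> R) :
  \big[op/idx]_(p : {i : I & 'I_(k i)}) F p =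
  \big[op/idx]_(i : I) \big[op/idx]_(j < k i)
    F (@Tagged _ i (fun i => 'I_(k i)) j).
Proof.
by rewrite sig_big_dep /=; apply: eq_bigr => -[].
Qed.

(** Stated for an arbitrary commutative monoid, because it is applied to
    degrees, which are sums of natural numbers, and to quadratic forms. *)
Lemma big_hang_leaves {R : Type} {idx : R} (op : Monoid.com_law idx)
    (G : multigraph) (k : edge G -> nat)
    (F : vertex (hang_leaves G k) -> vertex (hang_leaves G k) -> R) :
  \big[op/idx]_(x : edge (hang_leaves G k)) F (src x) (tgt x) =
  op (\big[op/idx]_(e : edge G) \big[op/idx]_(i < (k e).+1)
        F (walk k e i) (walk k e i.+1))
     (\big[op/idx]_(e : edge G) \big[op/idx]_(j < k e)
        F (walk k e j.+1) (inr (inr (@Tagged _ e (fun e => 'I_(k e)) j)))).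
Proof.
rewrite big_sumType /=; congr (op _ _); rewrite big_slot //=.
by apply: eq_bigr => e _; apply: eq_bigr => j _; rewrite walk_inner.
Qed.

Lemma big_walk {R : Type} {idx : R} (op : Monoid.com_law idx) {G : multigraph}
    (k : edge G -> nat) (e : edge G) (f : vertex (hang_leaves G k) -> R) :
  \big[op/idx]_(i < (k e).+1) op (f (walk k e i)) (f (walk k e i.+1)) =
  op (op (f (inl (src e))) (f (inl (tgt e))))
     (\big[op/idx]_(j < k e) op (f (walk k e j.+1)) (f (walk k e j.+1))).
Proof.
rewrite !big_split /= big_ord_recl.
rewrite [\big[op/idx]_(i < (k e).+1) _]big_ord_recr /=.
by rewrite walk_last [X in op _ X = _]Monoid.mulmC Monoid.mulmACA.
Qed.

(** The Cauchy-Schwarz inequality for a telescoping sum of n terms. *)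
Lemma path_sqr {R : realType} (u : nat -> R) (m n : nat) :
  (u (m + n)%N - u m) ^+ 2 <=
  n%:R * \sum_(m <= i < m + n) (u i - u i.+1) ^+ 2.
Proof.
elim: n => [|n IHn].
  by rewrite addn0 big_geq // subrr expr0n mulr0.
rewrite addnS big_nat_recr ?leq_addr //=.
move: IHn; set D := \sum_(_ <= i < _) _; set a := u (m + n)%N => IHn.
have D0 : 0 <= D by apply: sumr_ge0 => i _; apply: sqr_ge0.
set y := u (m + n).+1.
have step : (y - u m) ^+ 2 =
    (a - u m) ^+ 2 + 2 * (a - u m) * (y - a) + (a - y) ^+ 2.
  by ring.
move: IHn; rewrite step -natr1.
have := sqr_ge0 ((a - u m) - n%:R * (y - a)).
have := sqr_ge0 (y - a).
have -> : (a - y) ^+ 2 = (y - a) ^+ 2 by ring.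
move: (a - u m) (y - a) => A d.
move=> d2 An AD; have [n0|n0] := posnP n.
  move: AD; rewrite n0 mul0r => A0.
  have /eqP : A ^+ 2 = 0 by apply/eqP; rewrite eq_le A0 sqr_ge0.
  by rewrite sqrf_eq0 => /eqP ->; lra.
have nR : 0 < n%:R :> R by rewrite ltr0n.
rewrite -(ler_pM2l nR).
nra.
Qed.

(** Let t be the number associated with the restriction of f to the old
    vertices, and consider one edge with ends x and y and path energy D.  An
    inserted value u is at squared distance at most M * D from the values at
    both ends, so that (u - t) ^+ 2 <= X + 2 * M * D where X is the sum of the
    squares of f x - t and f y - t.  The value at a leaf is controlled by the
    value at its neighbour and by the energy S of the stems.  With at most M inserted vertices, the edge
    contributes at most (1 + 5 * M) * X + 10 * M ^+ 2 * D + 2 * S to the spread.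
    Finally c times the sum of the X is at most the energy of the restriction,
    which is at most 2 * M times the sum of the D, since a path has at most
    M + 1 <= 2 * M edges.  The constant follows from
    (1 + 5 * M) * (2 * M) <= 12 * M ^+ 2. *)
Lemma poincare_hang_leaves {R : realType} (c M : R) (G : multigraph)
    (k : edge G -> nat) :
  0 < c -> 1 <= M -> (forall e, (k e)%:R <= M) -> poincare c G ->
  poincare (c / (M ^+ 2 * (12 + 10 * c))) (hang_leaves G k).
Proof.
move=> c0 M1 kM pG f.
have [t ft] := pG (fun v => f (inl v)); exists t.
pose u e i := f (walk k e i).
pose D e := \sum_(i < (k e).+1) (u e i - u e i.+1) ^+ 2.
pose l e (j : 'I_(k e)) := f (inr (inr (@Tagged _ e (fun e => 'I_(k e)) j))).
pose S e := \sum_(j < k e) (u e j.+1 - l e j) ^+ 2.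
pose X e := (f (inl (src e)) - t) ^+ 2 + (f (inl (tgt e)) - t) ^+ 2.
have D0 e : 0 <= D e by apply: sumr_ge0 => i _; apply: sqr_ge0.
have S0 e : 0 <= S e by apply: sumr_ge0 => i _; apply: sqr_ge0.
have X0 e : 0 <= X e by rewrite addr_ge0 ?sqr_ge0.
have EH : energy f = \sum_(e : edge G) (D e + S e).
  rewrite /energy (big_hang_leaves _ _ _ (fun v w => (f v - f w) ^+ 2)).
  by rewrite big_split.
(* An inserted vertex has degree 3 and a leaf has degree 1. *)
have SH : spread f t = \sum_(e : edge G) (X e +
    \sum_(j < k e) (3 * (u e j.+1 - t) ^+ 2 + (l e j - t) ^+ 2)).
  rewrite /spread.
  rewrite (big_hang_leaves _ _ _ (fun v w => (f v - t) ^+ 2 + (f w - t) ^+ 2)).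
  rewrite -big_split; apply: eq_bigr => e _ /=.
  rewrite (big_walk _ _ _ (fun v => (f v - t) ^+ 2)) -addrA -/(X e).
  congr (_ + _).
  rewrite -big_split; apply: eq_bigr => j _ /=.
  by rewrite -/(u e j.+1) -/(l e j); ring.
have part e m n : (m + n <= (k e).+1)%N ->
    (u e (m + n)%N - u e m) ^+ 2 <= n%:R * D e.
  move=> mn; apply: le_trans (path_sqr _ _ _) _; rewrite ler_wpM2l //.
  rewrite /D -(big_mkord xpredT (fun i => (u e i - u e i.+1) ^+ 2)).
  rewrite [leRHS](big_cat_nat (n := m)) //=; last by lia.
  rewrite [X in _ <= _ + X](big_cat_nat (n := (m + n)%N)) //=; last by lia.
  by rewrite addrCA lerDl addr_ge0 // sumr_ge0 // => i _; apply: sqr_ge0.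
have u0 e : u e 0%N = f (inl (src e)) by [].
have uk e : u e (k e).+1 = f (inl (tgt e)) by rewrite /u walk_last.
have GD : c * (\sum_e X e) <= 2 * M * (\sum_e D e).
  apply: le_trans ft _; rewrite mulr_sumr; apply: ler_sum => e _.
  have := part e 0%N (k e).+1 (leqnn _); rewrite add0n uk u0 -natr1.
  by have := kM e; have := D0 e; nra.
have inn e : \sum_(j < k e) (3 * (u e j.+1 - t) ^+ 2 + (l e j - t) ^+ 2) <=
    5 * M * X e + 10 * M ^+ 2 * D e + 2 * S e.
  have b (j : 'I_(k e)) : 3 * (u e j.+1 - t) ^+ 2 + (l e j - t) ^+ 2 <=
      5 * X e + 10 * M * D e + 2 * (u e j.+1 - l e j) ^+ 2.
    have jk := ltn_ord j.
    have := part e 0%N j.+1 (leqW jk); have := part e j.+1 (k e - j)%N.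
    rewrite addSn subnKC ?(ltnW jk) // leqnn uk add0n u0 => /(_ isT).
    have h1 : (k e - j)%:R <= M.
      by apply: le_trans (kM e); rewrite ler_nat leq_subr.
    have h2 : j.+1%:R <= M by apply: le_trans (kM e); rewrite ler_nat.
    have := ler_wpM2r (D0 e) h1; have := ler_wpM2r (D0 e) h2; rewrite /X.
    set a := u e j.+1; set b := l e j; set x := f (inl (src e)); set y := f _.
    move=> h3 h4 h5 h6.
    (* Each square is the bound (p + q) ^+ 2 <= 2 * p ^+ 2 + 2 * q ^+ 2 in
       disguise; the estimates of a from x and from y are averaged. *)
    have := sqr_ge0 ((x - t) - (a - x)); have := sqr_ge0 ((y - t) + (y - a)).
    have := sqr_ge0 ((a - t) - (b - a)).
    nra.
  apply: le_trans (ler_sum _ (fun j _ => b j)) _.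
  rewrite big_split /= sumr_const card_ord -mulr_sumr -/(S e) lerD2r -mulr_natl.
  have := ler_wpM2r (X0 e) (kM e); have := ler_wpM2r (D0 e) (kM e).
  by have := X0 e; have := D0 e; nra.
have main : c * spread f t <= M ^+ 2 * (12 + 10 * c) * energy f.
  rewrite SH EH !mulr_sumr.
  have GD' := ler_wpM2l (ltW (lt_le_trans ltr01 M1)) GD.
  apply: (@le_trans _ _
    (\sum_e (c * (1 + 5 * M) * X e + c * (10 * M ^+ 2 * D e + 2 * S e)))).
    apply: ler_sum => e _; have := ler_wpM2l (ltW c0) (inn e); lra.
  rewrite big_split /= -mulr_sumr.
  apply: (@le_trans _ _
    (\sum_e (12 * M ^+ 2 * D e + c * (10 * M ^+ 2 * D e + 2 * S e)))).
    rewrite [leRHS]big_split /= lerD2r -mulr_sumr.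
    have : 0 <= M * (M - 1) * \sum_e D e.
      by rewrite mulr_ge0 ?sumr_ge0 // mulr_ge0 ?subr_ge0 // (le_trans ler01).
    by move: GD GD'; move: (\sum_e D e) (\sum_e X e) => SD SX; lra.
  apply: ler_sum => e _.
  have : c * S e <= c * (M ^+ 2 * S e).
    by rewrite ler_pM2l // ler_peMl // expr_ge1 // (le_trans ler01).
  have : 0 <= M ^+ 2 * S e by rewrite mulr_ge0 ?sqr_ge0.
  have := mulr_ge0 (ltW c0) (S0 e).
  have := D0 e; have := S0 e; nra.
have M0 : 0 < M ^+ 2 by rewrite exprn_gt0 // (lt_le_trans ltr01).
by rewrite mulrAC ler_pdivrMr ?(mulrC (energy f)) // mulr_gt0 //; lra.
Qed.

Lemma degree_hang_leaves (G : multigraph) (k : edge G -> nat)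
    (v : vertex (hang_leaves G k)) :
  degree v = match v with
             | inl w => degree w
             | inr (inl _) => 3%N
             | inr (inr _) => 1%N end.
Proof.
rewrite degree_sum.
rewrite (big_hang_leaves _ _ _ (fun x y => (x == v) + (y == v))%N) /=.
pose H := hang_leaves G k.
have -> : (\sum_e \sum_(i < (k e).+1)
      ((walk k e i == v :> vertex H) + (walk k e i.+1 == v :> vertex H)) =
    \sum_e ((inl (src e) == v :> vertex H) + (inl (tgt e) == v :> vertex H)) +
    \sum_(p : slot G k)
      ((inr (inl p) == v :> vertex H) + (inr (inl p) == v :> vertex H)))%N.
  rewrite (big_slot _ k) -big_split /=; apply: eq_bigr => e _.
  rewrite (big_walk _ _ _ (fun x => (x == v) : nat)) /=; congr (_ + _)%N.
  by apply: eq_bigr => j _; rewrite walk_inner.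
have -> : (\sum_e \sum_(j < k e) ((walk k e j.+1 == v :> vertex H) +
      (inr (inr (@Tagged _ e (fun e => 'I_(k e)) j)) == v :> vertex H)) =
    \sum_(p : slot G k)
      ((inr (inl p) == v :> vertex H) + (inr (inr p) == v :> vertex H)))%N.
  rewrite (big_slot _ k); apply: eq_bigr => e _.
  by apply: eq_bigr => j _; rewrite walk_inner.
have sum_eq (T : finType) (x : T) : (\sum_y (y == x) = 1)%N.
  by rewrite (bigD1 x) //= eqxx big1 // => y /negbTE->.
case: v => [w|[p|p]].
- rewrite degree_sum [X in (_ + X + _)%N]big1 // [X in (_ + X)%N]big1 // !addn0.
  by apply: eq_bigr => e _.
- rewrite [X in (X + _ + _)%N]big1 // !big_split /=.
  by rewrite [X in (_ + (_ + X))%N]big1 // !sum_eq.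
- rewrite [X in (X + _ + _)%N]big1 // [X in (_ + X + _)%N]big1 // !big_split /=.
  by rewrite [X in (_ + (X + _))%N]big1 // !sum_eq.
Qed.

Lemma card_slot (G : multigraph) (k : edge G -> nat) :
  #|slot G k| = (\sum_e k e)%N.
Proof.
rewrite -sum1_card (big_slot _ _ (fun=> 1%N)).
by apply: eq_bigr => e _; rewrite sum1_card card_ord.
Qed.

(** A cubic graph on 2m vertices has genus m + 1, and neither subdividing nor
    hanging leaves changes the genus. *)
Lemma in_F_hang_leaves {R : realType} (c : R) (G : multigraph) (m n : nat)
    (k : edge G -> nat) :
  0 < c -> poincare c (hang_leaves G k) -> (0 < m)%N -> regular G 3 ->
  #|vertex G| = (2 * m)%N -> (\sum_e k e = n)%N ->
  in_F (hang_leaves G k) m.+1 n.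
Proof.
move=> c0 pH m0 G3 Gm kn.
have cV : #|vertex (hang_leaves G k)| = (2 * m + (n + n))%N.
  by rewrite card_sum Gm card_sum -kn -card_slot.
split; first by lia.
  apply: poincare_connected pH => // [|v]; first by rewrite cV; lia.
  by rewrite degree_hang_leaves; case: v => [w|[p|p]] //; rewrite G3.
pose leaves : {set vertex (hang_leaves G k)} :=
  [set inr (inr p) | p : slot G k].
have cL : #|leaves| = n by rewrite card_imset ?card_slot // => p q [].
exists leaves; split=> //.
- have := cardsC leaves; rewrite cL cV; lia.
- move=> v; rewrite degree_hang_leaves; case: v => [w|[p|p]] //.
  by case/negP; apply/imsetP; exists p.
- by move=> v /imsetP [p _ ->]; rewrite degree_hang_leaves.
Qed.

(** * The spectrum of the Laplacian *)

(** Over the complex numbers, a real symmetric matrix is unitarily diagonalizable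
    with real diagonal.  Not all diagonal entries vanish, and a nonzero one is
    an eigenvalue of S already over R, because having an eigenvalue does not
    depend on the field. *)
Lemma symmetric_nonzero_eigenvalue {R : rcfType} {n : nat} (S : 'M[R]_n) :
  S^T = S -> S != 0 -> exists2 r, r != 0 & eigenvalue S r.
Proof.
move=> symS S0; pose C : numClosedFieldType := complex R.
pose inC := real_complex R : {rmorphism R -> C}.
pose A : 'M[C]_n := map_mx inC S.
have Aherm : A \is hermsymmx.
  apply: realsym_hermsym.
    apply/is_hermitianmxP.
    by rewrite expr0 scale1r map_mx_id // /A map_trmx symS.
  by apply/mxOverP => i j; rewrite mxE; apply/complex_realP; exists (S i j).
have Aeq := orthomx_spectralP (hermitian_normalmx Aherm).
have sp_real := hermitian_spectral_diag_real Aherm.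
have P1 := spectral_unit A.
move: (spectralmx A) (spectral_diag A) Aeq sp_real P1.
move=> P sp Aeq sp_real P1.
have [i spi] : exists i, sp 0 i != 0.
  apply/existsP; apply: contraNT S0; rewrite negb_exists => /forallP sp0.
  rewrite -(map_mx_eq0 inC) -/A Aeq.
  have -> : sp = 0.
    by apply/rowP => i; rewrite mxE; apply/eqP; have := sp0 i; rewrite negbK.
  have -> : diag_mx 0 = 0 :> 'M[C]_n.
    by apply/matrixP => i j; rewrite !mxE mul0rn.
  by rewrite mulmx0 mul0mx.
have /complex_realP [r spr] := mxOverP sp_real 0 i.
(* The rows of the diagonalizing matrix are eigenvectors. *)
exists r; first by apply: contraNneq spi => r0; rewrite spr r0.
rewrite -(eigenvalue_map inC); apply/eigenvalueP; exists (row i P).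
  rewrite -/A Aeq !mulmxA -row_mul mulmxV // -row_mul mul1mx.
  by rewrite row_diag_mx -scalemxAl -rowE spr.
apply: contraTneq P1 => Pi0; apply/negP => P1.
have := mulmxV P1 => /(congr1 (row i)); rewrite row_mul Pi0 mul0mx row1.
by move=> /rowP /(_ i); rewrite !mxE !eqxx => /esym/eqP; rewrite oner_eq0.
Qed.

Lemma all_roots {F : fieldType} (p : {poly F}) :
  p != 0 -> exists s : seq F, uniq s /\ forall a, root p a -> a \in s.
Proof.
have [n] := ubnP (size p); elim: n p => // n IHn p pn p0.
have [[a ra]|nr] := pselect (exists a, root p a); last first.
  by exists [::]; split=> // a ra; case: nr; exists a.
have [q pq] := factor_theorem p a ra.
have q0 : q != 0 by apply: contraNneq p0 => q0; rewrite pq q0 mul0r.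
have [|s [us sP]] := IHn q _ q0.
  by move: pn; rewrite pq size_mul ?polyXsubC_eq0 // size_XsubC addn2 /= ltnS.
exists (undup (a :: s)); split; first exact: undup_uniq.
move=> b; rewrite pq rootM root_XsubC mem_undup inE => /orP [/sP ->|->] //.
by rewrite orbT.
Qed.

Lemma mem_leigenspace {F : fieldType} {V : vectType F} (u : 'End(V))
    (a : F) (v : V) :
  (v \in passmx.leigenspace u a) = (u v == a *: v).
Proof.
by rewrite memv_ker add_lfunE opp_lfunE scale_lfunE id_lfunE subr_eq0.
Qed.

(** The defining condition of [spectrum] can be met: all eigenvalues are roots of
    the characteristic polynomial, so finitely many eigenspaces are nonzero. *)
Lemma spectrumP {R : realType} {V : vectType R} (u : 'End(V)) :
  sorted <=%R (spectrum u) /\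
  forall a, count_mem a (spectrum u) = \dim (passmx.leigenspace u a).
Proof.
pose d (a : R) : nat := \dim (passmx.leigenspace u a).
suff [s sP] : exists s : seq R, sorted <=%R s /\ forall a, count_mem a s = d a.
  by rewrite /spectrum; case: xgetP => [s' -> //|/(_ s)].
pose e := vbasis (fullv : {vspace V}).
have eb : basis_of fullv e := vbasisP _.
have [r [ur rP]] :=
  all_roots _ (monic_neq0 (char_poly_monic (passmx.mxof e e u))).
have dP a : d a != 0%N -> a \in r.
  rewrite dimv_eq0 (passmx.leigenspaceE eb) passmx.vsof_eq0 // => ha.
  by apply: rP; rewrite -eigenvalue_root_char.
exists (sort <=%R (flatten [seq nseq (d b) b | b <- r])); split.
  exact: (sort_sorted le_total).
move=> a; rewrite (permP (permEl (perm_sort _ _))).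
have -> : count_mem a (flatten [seq nseq (d b) b | b <- r]) =
    if a \in r then d a else 0%N.
  elim: r ur {rP dP} => //= b r IHr /andP [br ur].
  rewrite count_cat count_nseq IHr // in_cons /= eq_sym.
  case: (eqVneq a b) => [->|_] /=; last by rewrite mul0n.
  by rewrite (negbTE br) mul1n addn0.
case: ifPn => // ar; apply/esym/eqP; apply: contraNT ar; exact: dP.
Qed.

Definition dirichlet {R : realType} {G : multigraph} (f g : vertex G -> R) :
    R :=
  \sum_(e : edge G) (f (src e) - f (tgt e)) * (g (src e) - g (tgt e)).

(** Summation by parts: the Dirichlet form represents the negated Laplacian for
    the inner product weighted by the degrees. *)
Lemma green {R : realType} {G : multigraph} (f : {ffun vertex G -> R^o})
    (g : vertex G -> R) : (forall v : vertex G, (0 < degree v)%N) ->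
  \sum_v (degree v)%:R * neg_laplacian R G f v * g v = dirichlet f g.
Proof.
move=> dG; transitivity (\sum_v (
    \sum_(e : edge G | src e == v) (f (src e) - f (tgt e)) * g (src e) -
    \sum_(e : edge G | tgt e == v) (f (src e) - f (tgt e)) * g (tgt e))).
  apply: eq_bigr => v _; rewrite /neg_laplacian opp_lfunE lfunE /= !ffunE /=.
  rewrite mulrN mulrA mulfV ?mul1r; last by rewrite pnatr_eq0 -lt0n.
  rewrite mulNr mulrDl opprD !mulr_suml -!sumrN.
  by congr (_ + _); apply: eq_bigr => e /eqP <-; ring.
have fib (h : edge G -> vertex G) (F : edge G -> R) :
    \sum_v \sum_(e | h e == v) F e = \sum_e F e.
  rewrite (exchange_big_dep xpredT) //=; apply: eq_bigr => e _.
  by rewrite (big_pred1 (h e)) // => v; rewrite eq_sym.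
rewrite sumrB !fib -sumrB.
by apply: eq_bigr => e _; rewrite mulrBr.
Qed.

(** The functions b v form an orthonormal basis for the inner product weighted by
    the degrees.  The matrix S of the Dirichlet form in this basis is symmetric,
    its diagonal entries are energies of indicator functions up to positive
    factors, and by Green's formula its eigenvectors are the coordinate vectors
    of eigenfunctions of the Laplacian. *)
Lemma laplacian_nonzero_eigenvalue {R : realType} {G : multigraph} :
  (forall v : vertex G, (0 < degree v)%N) ->
  (exists v, 0 < energy (fun w : vertex G => (w == v)%:R : R)) ->
  exists2 r, r != 0 & passmx.leigenspace (neg_laplacian R G) r != 0%VS.
Proof.
move=> dG [v0 Ev0].
pose s (v : vertex G) : R := Num.sqrt (degree v)%:R.
have s_gt0 v : 0 < s v by rewrite sqrtr_gt0 ltr0n.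
have s_neq0 v : s v != 0 by rewrite gt_eqF.
have ss v : s v * s v = (degree v)%:R by rewrite -expr2 sqr_sqrtr.
pose b (v w : vertex G) : R := (w == v)%:R / s v.
pose S : 'M[R]_#|vertex G| :=
  \matrix_(i, j) dirichlet (b (enum_val i)) (b (enum_val j)).
have symS : S^T = S.
  by apply/matrixP => i j; rewrite !mxE; apply: eq_bigr => e _; rewrite mulrC.
have S0 : S != 0.
  apply/eqP => /matrixP /(_ (enum_rank v0) (enum_rank v0)).
  rewrite !mxE enum_rankK.
  have -> : dirichlet (b v0) (b v0) =
      energy (fun w => (w == v0)%:R) / (s v0 * s v0).
    rewrite /energy mulr_suml; apply: eq_bigr => e _.
    by rewrite /b; field; apply: s_neq0.
  by move/eqP; rewrite mulf_eq0 invr_eq0 mulf_eq0 !gt_eqF.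
have [r r0 /eigenvalueP [x xS x0]] := symmetric_nonzero_eigenvalue S symS S0.
exists r => //.
pose f : {ffun vertex G -> R^o} := [ffun v => x 0 (enum_rank v) / s v].
have fB v : dirichlet f (b v) = (x *m S) 0 (enum_rank v).
  rewrite mxE /dirichlet.
  under [RHS]eq_bigr => i _ do rewrite mxE enum_rankK mulr_sumr.
  rewrite exchange_big /=; apply: eq_bigr => e _.
  under [RHS]eq_bigr => i _ do rewrite mulrA.
  rewrite -mulr_suml; congr (_ * _).
  have fsum w : f w = \sum_i x 0 i * b (enum_val i) w.
    rewrite ffunE (bigD1 (enum_rank w)) //= enum_rankK /b eqxx mul1r.
    rewrite big1 ?addr0 //.
    move=> i iw; case: eqVneq => [wi|_]; last by rewrite mul0r mulr0.
    by rewrite wi enum_valK eqxx in iw.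
  by rewrite !fsum -sumrB; apply: eq_bigr => i _; rewrite mulrBr.
have Tf : neg_laplacian R G f = r *: f.
  apply/ffunP => v; apply: (mulfI (s_neq0 v)).
  have := green f (b v) dG; rewrite fB xS (bigD1 v) //=.
  rewrite big1 => [|w wv]; last first.
    by rewrite /b (negbTE wv) mul0r mulr0.
  rewrite addr0 /b eqxx mxE -ss => h.
  rewrite [X in _ = _ * X]ffunE /f ffunE.
  transitivity (r * x 0 (enum_rank v)).
    by rewrite -h div1r [RHS]mulrAC mulfK.
  by rewrite /GRing.scale /=; field; apply: s_neq0.
apply: contraNneq x0 => k0.
have : f \in passmx.leigenspace (neg_laplacian R G) r.
  by rewrite mem_leigenspace Tf.
rewrite k0 memv0 => /eqP f0; apply/eqP/rowP => i; rewrite mxE.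
move/ffunP: f0 => /(_ (enum_val i)); rewrite !ffunE enum_valK => /eqP.
by rewrite mulf_eq0 invr_eq0 (negbTE (s_neq0 _)) orbF => /eqP.
Qed.

(** Every eigenvalue is 0 or at least c, the eigenvalue 0 is simple, and there is
    a nonzero eigenvalue.  Hence the spectrum has at least two entries, and if
    the second one were less than c, then both would be 0. *)
Lemma poincare_lambda1 {R : realType} (c : R) (G : multigraph) :
  0 < c -> (1 < #|vertex G|)%N -> (forall v : vertex G, (0 < degree v)%N) ->
  poincare c G -> c <= lambda R G 1.
Proof.
move=> c0 G2 dG pG; set T := neg_laplacian R G.
have spread_deg (f : vertex G -> R) t :
    spread f t = \sum_v (degree v)%:R * (f v - t) ^+ 2.
  by rewrite (sum_degree (fun v => (f v - t) ^+ 2)).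
have energy0 (f : vertex G -> R) : energy f = 0 -> exists t, forall v, f v = t.
  move=> f0; have [t] := pG f; exists t => v.
  have : spread f t = 0.
    apply/eqP; rewrite eq_le spread_ge0 andbT -(ler_pM2l c0) mulr0.
    by rewrite -f0.
  rewrite spread_deg => /eqP; rewrite psumr_eq0 => [|w _]; last first.
    by rewrite mulr_ge0 ?sqr_ge0.
  move=> /allP /(_ v); rewrite mem_index_enum => /(_ isT) /=.
  by rewrite mulf_eq0 pnatr_eq0 (gtn_eqF (dG v)) sqrf_eq0 subr_eq0 => /eqP.
have eig_energy a (f : {ffun vertex G -> R^o}) : T f = a *: f ->
    energy f = a * \sum_v (degree v)%:R * f v ^+ 2.
  move=> Tf; have := green f f dG; rewrite -/T Tf => E.
  rewrite [LHS](_ : _ = dirichlet f f); last first.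
    by apply: eq_bigr => e _; rewrite expr2.
  rewrite -E mulr_sumr; apply: eq_bigr => v _.
  by rewrite ffunE /GRing.scale /=; ring.
have eig_mean a (f : {ffun vertex G -> R^o}) : T f = a *: f ->
    a * (\sum_v (degree v)%:R * f v) = 0.
  move=> Tf; have := green f (fun=> 1) dG; rewrite -/T Tf => E.
  rewrite -[RHS](_ : dirichlet f (fun=> 1) = 0); last first.
    by apply: big1 => e _; rewrite subrr mulr0.
  rewrite -E mulr_sumr; apply: eq_bigr => v _.
  by rewrite ffunE /GRing.scale /=; ring.
have eig_c a : passmx.leigenspace T a != 0%VS -> a = 0 \/ c <= a.
  move=> Ea; have [->|a0] := eqVneq a 0; [by left|right].
  pose f := vpick (passmx.leigenspace T a).
  have f0 : f != 0 by rewrite vpick0.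
  have /eqP Tf : T f == a *: f by rewrite -mem_leigenspace memv_pick.
  have /eqP := eig_mean a f Tf; rewrite mulf_eq0 (negbTE a0) /= => /eqP mean0.
  have [t] := pG f; rewrite (eig_energy a f Tf) spread_deg.
  set N := \sum_v _ * f v ^+ 2.
  have N0 : 0 < N.
    rewrite lt0r sumr_ge0 ?andbT => [|v _]; last by rewrite mulr_ge0 ?sqr_ge0.
    apply: contra f0; rewrite psumr_eq0 => [|v _]; last first.
      by rewrite mulr_ge0 ?sqr_ge0.
    move=> /allP h; apply/eqP/ffunP => v; have := h v; rewrite mem_index_enum.
    rewrite mulf_eq0 pnatr_eq0 (gtn_eqF (dG v)) sqrf_eq0 ffunE.
    by move=> /(_ isT) /eqP.
  (* As f has mean 0, moving t away from 0 only increases the spread. *)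
  have -> : \sum_v (degree v)%:R * (f v - t) ^+ 2 =
      N + t ^+ 2 * \sum_(v : vertex G) (degree v)%:R.
    transitivity (N - 2 * t * (\sum_v (degree v)%:R * f v)
                  + t ^+ 2 * \sum_(v : vertex G) (degree v)%:R).
      by rewrite !mulr_sumr -sumrB -big_split; apply: eq_bigr => v _ /=; ring.
    by rewrite mean0 mulr0 subr0.
  move=> h; rewrite -(ler_pM2r N0); apply: le_trans h; rewrite ler_pM2l // lerDl.
  by rewrite mulr_ge0 ?sqr_ge0 ?sumr_ge0.
pose one : {ffun vertex G -> R^o} := [ffun => 1].
have ker_le1 : (\dim (passmx.leigenspace T 0%R) <= 1)%N.
  suff /dimvS/leq_trans : (passmx.leigenspace T 0 <= <[one]>)%VS.
    by apply; rewrite dim_vline leq_b1.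
  apply/subvP => f; rewrite mem_leigenspace => /eqP /eig_energy; rewrite mul0r.
  move=> /energy0 [t ft]; apply/vlineP; exists t.
  by apply/ffunP => v; rewrite !ffunE ft /GRing.scale /= mulr1.
have ker_neq0 : passmx.leigenspace T 0 != 0%VS.
  apply/eqP => k0; have : one \in passmx.leigenspace T 0.
    rewrite mem_leigenspace scale0r /T /neg_laplacian opp_lfunE lfunE /= oppr_eq0.
    apply/eqP/ffunP => v; rewrite !ffunE.
    by rewrite !big1 ?addr0 ?mulr0 // => e _; rewrite !ffunE subrr.
  rewrite k0 memv0 => /eqP/ffunP.
  have /card_gt0P [v _] := ltnW G2.
  by move=> /(_ v); rewrite !ffunE => /eqP; rewrite oner_eq0.
have [r r0 rT] : exists2 r, r != 0 & passmx.leigenspace T r != 0%VS.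
  apply: laplacian_nonzero_eigenvalue => //.
  have /card_gt1P [v [w [_ _ vw]]] := G2.
  exists v; rewrite lt0r energy_ge0 andbT; apply/eqP => /energy0 [t tE].
  have := tE w; rewrite -(tE v) eqxx eq_sym (negbTE vw) => /esym/eqP.
  by rewrite oner_eq0.
have [ssorted scount] := spectrumP T; rewrite /lambda -/T.
have memS a : (a \in spectrum T) = (passmx.leigenspace T a != 0%VS).
  by rewrite -dimv_eq0 -scount -lt0n -has_count has_pred1.
move: ssorted (scount 0) memS; case: (spectrum T) => [|x [|y s]] /=.
- by move=> _ _ /(_ r); rewrite rT.
- move=> _ _ memS.
  have : r \in [:: x] by exact: etrans (memS r) rT.
  have : 0 \in [:: x] by exact: etrans (memS 0) ker_neq0.
  by rewrite !mem_seq1 => /eqP x0 /eqP rx; move: r0; rewrite rx -x0 eqxx.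
move=> /andP [xy _] count0 memS.
have /eig_c [y0|//] : passmx.leigenspace T y != 0%VS.
  by rewrite -memS !in_cons eqxx orbT.
have /eig_c [x0|cx] : passmx.leigenspace T x != 0%VS.
  by rewrite -memS in_cons eqxx.
- by move: ker_le1; rewrite -count0 x0 y0 eqxx.
- by move: (lt_le_trans c0 (le_trans cx xy)); rewrite y0 ltxx.
Qed.

(** * The family of graphs *)

Definition even_split (T : finType) (n : nat) (x : T) : nat :=
  (n %/ #|T| + (enum_rank x < n %% #|T|))%N.

Lemma sum_even_split (T : finType) (n : nat) :
  (0 < #|T|)%N -> (\sum_(x : T) even_split T n x = n)%N.
Proof.
move=> T0; rewrite big_split /= sum_nat_const.
rewrite [X in (_ + X = _)%N](_ : _ = n %% #|T|)%N; last first.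
  rewrite (reindex_onto (@enum_val T predT) enum_rank) => [|x _]; last first.
    exact: enum_rankK.
  under eq_bigl => i do rewrite enum_valK eqxx.
  under eq_bigr => i _ do rewrite enum_valK.
  rewrite -(big_mkord xpredT (fun i => (i < n %% #|T| : nat)%N)).
  rewrite (big_cat_nat (n := (n %% #|T|)%N)) //=; last by rewrite ltnW // ltn_mod.
  rewrite (eq_big_nat _ _ (F2 := fun=> 1%N)) => [|i /andP [_ ->]] //.
  rewrite [X in (_ + X)%N]big1_seq => [|i]; last first.
    by rewrite mem_index_iota leqNgt => /and3P [_ /negbTE->].
  by rewrite addn0 sum_nat_const_nat subn0 muln1.
by rewrite mulnC -divn_eq.
Qed.

Lemma even_split_le {R : realType} (T : finType) (n : nat) (x : T) (a : R) :
  n%:R <= a * #|T|%:R -> (even_split T n x)%:R <= a + 1.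
Proof.
move=> na; have T0 : 0 < #|T|%:R :> R.
  by rewrite ltr0n; apply/card_gt0P; exists x.
rewrite natrD lerD //; last by case: (_ < _)%N.
rewrite -(ler_pM2r T0) -natrM; apply: le_trans na.
by rewrite ler_nat leq_trunc_div.
Qed.

Local Open Scope classical_set_scope.

(** The quotient lies between theta - (theta + 1) / g and theta. *)
Lemma truncn_mul_pred_cvg {R : realType} (theta : R) : 0 < theta ->
  ((Num.truncn (theta * g.-1%:R))%:R / g%:R : R) @[g --> \oo] --> theta.
Proof.
move=> t0.
have inv0 : (g%:R^-1 : R) @[g --> \oo] --> (0 : R).
  apply/(gtr0_cvgV0 (f := fun g : nat => g%:R : R)); last exact: cvgr_idn.
  by exists 1%N => // g /= g0; rewrite ltr0n.
have lim : (theta - (theta + 1) * g%:R^-1 : R) @[g --> \oo] --> theta.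
  rewrite -[X in _ --> X]subr0 -[X in _ --> _ - X](mulr0 (theta + 1)).
  by apply: cvgB; [exact: cvg_cst | apply: cvgM => //; exact: cvg_cst].
apply: (squeeze_cvgr _ lim (cvg_cst theta)).
near=> g.
have g0 : (0 < g)%N by near: g; exists 1%N.
have gR : 0 < g%:R :> R by rewrite ltr0n.
have pos : 0 <= theta * g.-1%:R by rewrite mulr_ge0 // ltW.
have /andP [lo hi] := truncn_itv pos.
have gE : g.-1%:R = g%:R - 1 :> R by rewrite -subn1 natrB.
rewrite gE in pos lo hi.
rewrite ler_pdivlMr // ler_pdivrMr // mulrBl divfK ?gt_eqF //.
rewrite gE; move: hi; rewrite -natr1 => hi; apply/andP; split; lra.
Unshelve. all: end_near.
Qed.

Theorem proposition3p2 (R : realType) (eta0 : R) (G : nat -> multigraph)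
    (eta0_gt0 : 0 < eta0)
    (G_connected : forall m : nat, (1 <= m)%N -> mg_connected (G m))
    (G_cubic : forall m : nat, (1 <= m)%N -> regular (G m) 3)
    (G_card : forall m : nat, (1 <= m)%N -> #|vertex (G m)| = (2 * m)%N)
    (G_cheeger : forall m : nat, (1 <= m)%N -> eta0 <= cheeger R (G m)) :
  let alpha0 : R := Num.min (1 / 2) (eta0 / (4 + eta0)) in
  0 < alpha0 /\
  forall theta : R, 0 < theta ->
    exists (n : nat -> nat) (H : nat -> multigraph),
      [/\ (forall g : nat, (2 <= g)%N -> in_F (H g) g (n g)),
          ((n g)%:R / g%:R : R) @[g --> \oo] --> theta &
          (forall g : nat, (2 <= g)%N ->
             alpha0 ^+ 2 / (2 * (theta + 3) ^+ 2) <= lambda R (H g) 1)].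
Proof.
move=> alpha0.
have eta4 : 0 < 4 + eta0 by lra.
have alpha0_gt0 : 0 < alpha0 by rewrite lt_min !divr_gt0.
split=> // theta theta0.
pose n g := Num.truncn (theta * g.-1%:R).
pose k g := even_split (edge (G g.-1)) (n g).
pose H g := hang_leaves (G g.-1) (k g).
have card_edge m : (0 < m)%N -> #|edge (G m)| = (3 * m)%N.
  move=> m0; have := card_edge_regular _ _ (G_cubic m m0).
  by rewrite G_card //; lia.
pose c := eta0 ^+ 2 / (2 * 3%:R ^+ 2).
have c0 : 0 < c by rewrite divr_gt0 ?mulr_gt0 ?exprn_gt0.
pose M := theta / 3 + 1.
have M1 : 1 <= M by rewrite lerDr divr_ge0 // ltW.
pose cH := c / (M ^+ 2 * (12 + 10 * c)).
have cH0 : 0 < cH.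
  by rewrite divr_gt0 // mulr_gt0 ?exprn_gt0 ?(lt_le_trans ltr01 M1) //; lra.
have pH g : (2 <= g)%N -> poincare cH (H g).
  move=> g2; have m0 : (0 < g.-1)%N by lia.
  apply: poincare_hang_leaves => // [e|]; last first.
    apply: cheeger_poincare (G_cheeger _ m0) => //; last exact: G_cubic.
    by rewrite G_card //; lia.
  apply: even_split_le; rewrite card_edge // natrM mulrA divfK //.
  by rewrite truncn_le mulr_ge0 // ltW.
have sumk g : (2 <= g)%N -> (\sum_e k g e = n g)%N.
  by move=> g2; apply: sum_even_split; rewrite card_edge; lia.
exists n, H; split.
- move=> g g2; have gE : g = g.-1.+1 by lia.
  rewrite [X in in_F _ X]gE.
  apply: in_F_hang_leaves (pH g g2) _ _ _ (sumk g g2) => //.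
  + lia.
  + by apply: G_cubic; lia.
  + by apply: G_card; lia.
- exact: truncn_mul_pred_cvg.
move=> g g2; have m0 : (0 < g.-1)%N by lia.
apply: (@le_trans _ _ cH); last first.
  apply: poincare_lambda1 (pH g g2) => //.
    by rewrite card_sum G_card //; lia.
  move=> v; rewrite degree_hang_leaves; case: v => [w|[p|p]] //.
  by rewrite G_cubic.
(* It remains to see that alpha0 ^+ 2 / (18 * M ^+ 2) <= cH.  The factor M ^+ 2
   cancels; then 12 * alpha0 ^+ 2 <= 12 / 16 * (18 * c) because
   alpha0 <= eta0 / 4, and 10 * c * alpha0 ^+ 2 <= 10 / 4 * c because
   alpha0 <= 1 / 2. *)
have -> : theta + 3 = 3 * M by rewrite /M; field.
have a_half : alpha0 <= 1 / 2 by rewrite ge_min lexx.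
have a_eta : alpha0 * 4 <= eta0.
  have : alpha0 <= eta0 / (4 + eta0) by rewrite ge_min lexx orbT.
  by rewrite ler_pdivlMr // => h; nra.
have M0 : 0 < M by exact: lt_le_trans ltr01 M1.
rewrite /cH ler_pdivlMr; last by rewrite mulr_gt0 ?exprn_gt0 //; lra.
rewrite mulrAC ler_pdivrMr; last by rewrite mulr_gt0 ?exprn_gt0 ?mulr_gt0.
have -> : alpha0 ^+ 2 * (M ^+ 2 * (12 + 10 * c)) =
    M ^+ 2 * (12 * alpha0 ^+ 2 + 10 * c * alpha0 ^+ 2) by ring.
have -> : c * (2 * (3 * M) ^+ 2) = M ^+ 2 * (18 * c) by ring.
apply: ler_wpM2l; first exact: sqr_ge0.
have cE : eta0 ^+ 2 = 18 * c by rewrite /c; field.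
have : 16 * alpha0 ^+ 2 <= 18 * c by rewrite -cE; nra.
have : alpha0 ^+ 2 <= 1 / 4 by nra.
by move=> h1 h2; nra.
Qed.
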